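(* Let $B_i\colon\mathbb{R}^d\to\mathbb{R}^{d_i}$ ($i=1,\dots,k$) be surjective linear maps and $c_i>0$. Suppose $p\ge1$ and $\theta_1,\dots,\theta_k$ are nonzero real numbers with $\theta_1+\dots+\theta_k=1$ such that $\theta_i>0$ for precisely one index $i$. Define $p_i$ by $c_i\left(1-\frac1p\right)=\theta_i\left(1-\frac1{p_i}\right)$. Then for non-negative measurable $f$ on $\mathbb{R}^d$, $$\|f\|_{L^p(\mathbb{R}^d)}\ge\mathrm{BL}(\mathbf{B},\mathbf{c})^{\frac1p-1}\prod_{i=1}^k\|(B_i)_*f\|_{L^{p_i}(\mathbb{R}^{d_i})}^{\theta_i}.$$
   Context: $\mathrm{BL}(\mathbf{B},\mathbf{c})\in(0,\infty]$ is the best constant such that $\int_{\mathbb{R}^d}\prod_i f_i(B_ix)^{c_i}dx\le\mathrm{BL}(\mathbf{B},\mathbf{c})\prod_i(\int_{\mathbb{R}^{d_i}}f_i)^{c_i}$ for all non-negative integrable $f_i$. For surjective linear $B\colon\mathbb{R}^d\to\mathbb{R}^{d'}$ and $f\ge0$ on $\mathbb{R}^d$, the pushforward $B_*f$ is defined by $\int_{\mathbb{R}^{d'}}B_*f(y)F(y)\,dy=\int_{\mathbb{R}^d}f(x)F(Bx)\,dx$ for all measurable $F\ge0$. *)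

(* Defs.v *)
From HB Require Import structures.
From mathcomp Require Import all_boot all_order all_algebra.
From mathcomp Require Import all_classical all_reals all_analysis measurable_realfun.

Set Implicit Arguments.
Unset Strict Implicit.
Unset Printing Implicit Defensive.
Import Order.TTheory GRing.Theory Num.Theory.

Local Open Scope classical_set_scope.
Local Open Scope ring_scope.

(* R^n is modelled as n.-tuple R, with the library's product (Borel)
   sigma-algebra on tuples. *)

(* Lebesgue measure on R^n, built as the iterated product measure
   (same construction as the library's product_measure1):
   leb 0 = Dirac mass on the unique point of R^0,
   leb (n+1) A = \int_R leb n (section of A at x) dx. *)
Fixpoint leb (R : realType) (n : nat) : set (n.-tuple R) -> \bar R :=
  match n with
  | 0 => fun A => ((\1_A [tuple]) : R)%:E
  | m.+1 => fun A =>
      (\int[@lebesgue_measure R]_x @leb R m [set t | A (cons_tuple (x : R) t)])%E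
  end.

Definition linmap (R : realType) (m n : nat) (B : 'M[R]_(m, n))
  (x : n.-tuple R) : m.-tuple R :=
  [tuple \sum_(j < n) B i j * tnth x j | i < m].

Definition epow (R : realType) (x : \bar R) (s : R) : \bar R :=
  if s == 0 then 1%E
  else if 0 < s then
    match x with
    | r%:E => (powR r s)%:E
    | +oo%E => +oo%E
    | -oo%E => 0%E
    end
  else
    match x with
    | r%:E => if r == 0 then +oo%E else (powR r s)%:E
    | +oo%E => 0%E
    | -oo%E => 0%E
    end.

(* L^q "norm" on R^n of a nonnegative g, parametrised by the reciprocal
   exponent r = 1/q (r = 0 <-> q = oo):
     r <> 0 : (\int g^(1/r))^r   (this covers q >= 1, 0 < q < 1 and q < 0)
     r = 0  : essential supremum. *)
Definition Lnormr (R : realType) (n : nat) (r : R)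
  (g : n.-tuple R -> \bar R) : \bar R :=
  if r == 0 then ereal_inf [set M : \bar R | @leb R n [set x | (M < g x)%E] = 0%E]
  else epow (\int[@leb R n]_x epow (g x) r^-1)%E r.

Definition is_pushforward (R : realType) (m n : nat) (B : 'M[R]_(m, n))
  (f : n.-tuple R -> R) (g : m.-tuple R -> \bar R) : Prop :=
  [/\ measurable_fun [set: m.-tuple R] g,
      (forall y, (0 <= g y)%E) &
      forall F : m.-tuple R -> R, measurable_fun [set: m.-tuple R] F ->
        (forall y, 0 <= F y) ->
        (\int[@leb R m]_y (g y * (F y)%:E))%E =
        (\int[@leb R n]_x (f x * F (linmap B x))%:E)%E].

Definition BLconst (R : realType) (d k : nat) (dims : 'I_k -> nat)
  (B : forall i : 'I_k, 'M[R]_(dims i, d)) (c : 'I_k -> R) : \bar R :=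
  ereal_inf [set C : \bar R | (0 <= C)%E /\
    forall fs : forall i : 'I_k, (dims i).-tuple R -> R,
      (forall i, measurable_fun [set: (dims i).-tuple R] (fs i)) ->
      (forall i y, 0 <= fs i y) ->
      (forall i, (\int[@leb R (dims i)]_y (fs i y)%:E < +oo)%E) ->
      (\int[@leb R d]_x (\prod_(i < k) powR (fs i (linmap (B i) x)) (c i))%:E
        <= C * \prod_(i < k) epow (\int[@leb R (dims i)]_y (fs i y)%:E) (c i))%E].

(* Main.v *)
Require Import Defs.
From HB Require Import structures.
From mathcomp Require Import all_boot all_order all_algebra.
From mathcomp Require Import all_classical all_reals all_analysis measurable_realfun.
From mathcomp Require Import ring.
Import Order.TTheory GRing.Theory Num.Theory.
Local Open Scope classical_set_scope.
Local Open Scope ring_scope.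
Set Implicit Arguments.
Unset Strict Implicit.
Unset Printing Implicit Defensive.

(* Write s = 1 - 1/p, r_i = 1/p_i, f_i = (B_i)_* f, and let theta_0 be the
   positive exponent.  For densities G_i with integral 1 the function
   f(x) G_0(B_0 x)^(c_0 s / theta_0) is the product of
   [f(x) prod_i G_i(B_i x)^(c_i s)]^(1/theta_0) and of
   [f(x) G_i(B_i x)^(c_i s / theta_i)]^(-theta_i/theta_0) for i <> 0, where the
   outer exponents are nonnegative and sum to 1.  Hoelder's inequality and the
   Brascamp-Lieb inequality bound its integral; choosing G_i proportional to
   f_i^(p_i) for i <> 0 turns the bound into K with
   K^theta_0 = BL^s ||f||_p prod_(i <> 0) ||f_i||_(p_i)^(-theta_i).  Since the
   integral is that of f_0 G_0^(1 - r_0), the duality characterisation of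
   ||f_0||_(1/r_0), valid for every r_0 < 1 (including r_0 <= 0), gives
   ||f_0||_(p_0) <= K. *)

(** * Lebesgue measure on tuples *)

Lemma measurable_linmap (R : realType) (m n : nat) (B : 'M[R]_(m, n)) :
  measurable_fun [set: n.-tuple R] (linmap B).
Proof.
apply/measurable_fun_tnthP => i.
rewrite (_ : _ \o _ = fun x : n.-tuple R => \sum_(j < n) B i j * tnth x j).
  apply: measurable_sum => j; apply: measurable_funM => //.
  exact: measurable_tnth.
by apply/funext => x /=; rewrite tnth_mktuple.
Qed.

Definition tcons (R : realType) (n : nat) (xt : R * n.-tuple R) : n.+1.-tuple R :=
  cons_tuple xt.1 xt.2.
Arguments tcons : clear implicits.

Lemma measurable_tcons (R : realType) (n : nat) :
  measurable_fun [set: R * n.-tuple R] (tcons R n).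
Proof. by apply: measurable_cons. Qed.

(** Both sides integrate the measures of the sections at the first coordinate. A bundled [mu] equal
    to [leb] in dimension [n] makes the product measure available, so that the measure axioms can
    pass to dimension [n.+1]. *)
Lemma lebS (R : realType) (n : nat)
    (mu : {sigma_finite_measure set (n.-tuple R) -> \bar R}) :
  (mu : set _ -> \bar R) = @leb R n ->
  @leb R n.+1 = pushforward (product_measure1 (@lebesgue_measure R) mu) (tcons R n).
Proof.
move=> muE; apply/funext => A; rewrite /= /pushforward /product_measure1.
apply: eq_integral => x _ /=; rewrite muE; congr leb.
by apply/seteqP; split => t /=; rewrite xsectionE /= ?inE.
Qed.

Section sigma_finite_measure_of.
Context d (T : measurableType d) (R : realType).
Variables (mu : {measure set T -> \bar R}) (mu_fin : sigma_finite setT mu).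

Definition sigma_finite_of of sigma_finite setT mu := (mu : set T -> \bar R).

Local Notation nu := (sigma_finite_of mu_fin).

HB.instance Definition _ := Measure.copy nu mu.
HB.instance Definition _ := Measure_isSigmaFinite.Build _ _ _ nu mu_fin.

Definition sigma_finite_measure_of : {sigma_finite_measure set T -> \bar R} :=
  nu.

End sigma_finite_measure_of.

(** The product construction asks for a sigma-finite factor, so the induction carries the measure
    structure and sigma-finiteness together. *)
Lemma leb_sigma_finite_measure (R : realType) (n : nat) :
  exists mu : {sigma_finite_measure set (n.-tuple R) -> \bar R},
    (mu : set _ -> \bar R) = @leb R n.
Proof.
elim: n => [|n [mu muE]].
  exists (dirac [tuple] : {sigma_finite_measure set (0.-tuple R) -> \bar R}).
  by apply/funext => A; rewrite /= diracE indicE.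
have [nu nuE] : exists nu : {measure set (n.+1.-tuple R) -> \bar R},
    (nu : set _ -> \bar R) =
    pushforward (product_measure1 (@lebesgue_measure R) mu) (tcons R n).
  have mcons := @measurable_tcons R n.
  unshelve eexists; first exact:
    (measure_function_pushforward__canonical__measure_function_Measure
       (product_measure1 (@lebesgue_measure R) mu : {measure set _ -> \bar R})
       mcons).
  by [].
have nu_fin : sigma_finite setT nu.
  have /sigma_finiteP[F [FT ndF mF]] := sigma_finiteT (@lebesgue_measure R).
  have /sigma_finiteP[G [GT ndG mG]] := sigma_finiteT mu.
  (* Products of an exhaustion of the line with one of the space of tails; since both are
     increasing, the larger of two indices serves both coordinates. *)
  exists (fun k => [set t : n.+1.-tuple R | F k (thead t)] `&`
                   [set t : n.+1.-tuple R | G k [tuple of behead t]]).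
    apply/seteqP; split => // t _.
    have : [set: R] (thead t) by [].
    have : [set: n.-tuple R] [tuple of behead t] by [].
    rewrite FT GT => -[j _ Gj] [i _ Fi]; exists (maxn i j) => //; split => /=.
      by move/subsetPset : (ndF _ _ (leq_maxl i j)); exact.
    by move/subsetPset : (ndG _ _ (leq_maxr i j)); exact.
  move=> k; split.
    apply: measurableI.
      have := measurable_tnth (ord0 : 'I_n.+1) measurableT (mF k).1.
      by rewrite setTI.
    have := @measurable_behead _ R n measurableT _ (mG k).1.
    by rewrite setTI.
  rewrite nuE /pushforward (_ : _ @^-1` _ = F k `*` G k); last first.
    apply/funext => -[x t]; rewrite /preimage /= theadE.
    have E : [tuple of behead (tcons R n (x, t))] = t by apply: val_inj => /=.
    by rewrite E.
  rewrite product_measure1E; [|exact: (mF k).1|exact: (mG k).1].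
  apply: lte_mul_pinfty => //; last exact: (mG k).2.
  by rewrite ge0_fin_numE// (mF k).2.
exists (sigma_finite_measure_of nu_fin).
by rewrite (lebS muE) -nuE.
Qed.

Section leb_instance.
Context (R : realType) (n : nat).

Let leb0 : @leb R n set0 = 0%E.
Proof. by have [mu <-] := leb_sigma_finite_measure R n. Qed.

Let leb_ge0 A : (0 <= @leb R n A)%E.
Proof. by have [mu <-] := leb_sigma_finite_measure R n. Qed.

Let leb_semi_sigma_additive : semi_sigma_additive (@leb R n).
Proof.
have [mu <-] := leb_sigma_finite_measure R n.
exact: measure_semi_sigma_additive.
Qed.

HB.instance Definition _ :=
  isMeasure.Build _ _ _ (@leb R n) leb0 leb_ge0 leb_semi_sigma_additive.

Let leb_sigma_finite : sigma_finite setT (@leb R n).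
Proof.
have [mu <-] := leb_sigma_finite_measure R n.
exact: sigma_finiteT.
Qed.

HB.instance Definition _ :=
  Measure_isSigmaFinite.Build _ _ _ (@leb R n) leb_sigma_finite.

End leb_instance.

Lemma leb_setT_gt0 (R : realType) (n : nat) : (0 < @leb R n setT)%E.
Proof.
elim: n => [|n ih]; first by rewrite /= indicE in_setT lte01.
rewrite /= (_ : (fun _ => _) = cst (@leb R n setT)).
  have lebT : (0 < @lebesgue_measure R [set: R])%E.
    by rewrite -set_itvNyy lebesgue_measure_itv /= addye // ltry.
  by rewrite integral_cst//; exact: mule_gt0 ih lebT.
by apply/funext => x /=; congr leb; exact/seteqP.
Qed.

(** * Extended powers and normalised powers *)

Lemma measurable_fun_powR d (T : measurableType d) (R : realType)
    (f : T -> R) s : measurable_fun setT f ->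
  measurable_fun setT (fun x => f x `^ s).
Proof. by move=> mf; exact: measurableT_comp (measurable_powR s) mf. Qed.

Section epow_theory.
Context (R : realType).
Implicit Types (x : \bar R) (r s : R).

Lemma epow_ge0 x s : (0 <= epow x s)%E.
Proof.
rewrite /epow; case: ifP => // _; case: ifP => _; case: x => [r| |] //=.
- by rewrite lee_fin powR_ge0.
- by case: ifP => // _; rewrite lee_fin powR_ge0.
Qed.

Lemma epowr0 x : epow x 0 = 1%E.
Proof. by rewrite /epow eqxx. Qed.

Lemma epow_EFin_pos r s : 0 < s -> epow r%:E s = (r `^ s)%:E.
Proof. by move=> s0; rewrite /epow gt_eqF// s0. Qed.

Lemma epow_EFin r s : 0 < r -> epow r%:E s = (r `^ s)%:E.
Proof.
move=> r0; rewrite /epow; have [->|s0] := eqVneq s 0; first by rewrite powRr0.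
by case: ifP => // _; rewrite gt_eqF.
Qed.

Lemma epow0_pos s : 0 < s -> epow 0 s = 0%E.
Proof. by move=> s0; rewrite epow_EFin_pos// powR0// gt_eqF. Qed.

Lemma epow0_neg s : s < 0 -> epow 0 s = +oo%E.
Proof. by move=> s0; rewrite /epow lt_eqF// lt_gtF//= eqxx. Qed.

Lemma epowy_pos s : 0 < s -> epow +oo s = +oo%E.
Proof. by move=> s0; rewrite /epow gt_eqF// s0. Qed.

Lemma epowy_neg s : s < 0 -> epow +oo s = 0%E.
Proof. by move=> s0; rewrite /epow lt_eqF// lt_gtF. Qed.

Lemma epowr1 x : (0 <= x)%E -> epow x 1 = x.
Proof.
case: x => [r| |]//; last by rewrite epowy_pos.
by rewrite lee_fin => r0; rewrite epow_EFin_pos// powRr1.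
Qed.

Lemma measurable_epow s : measurable_fun [set: \bar R] (@epow R ^~ s).
Proof.
have mpow : measurable_fun [set: \bar R] (fun x : \bar R => (fine x `^ s)%:E).
  by apply/measurable_EFinP; apply: measurable_fun_powR; exact: fine_measurable.
have [->|s0] := eqVneq s 0.
  by rewrite (_ : @epow R ^~ 0 = cst 1%E)//; apply/funext => x; rewrite epowr0.
have [sp|sn] := ltP 0 s.
  rewrite (_ : @epow R ^~ s = fun x => if x == +oo%E then +oo%E else
      if x == -oo%E then 0%E else (fine x `^ s)%:E); last first.
    by apply/funext => x; rewrite /epow (negbTE s0) sp; case: x.
  apply: measurable_fun_ifT => //; first exact: measurable_fun_eqe.
  by apply: measurable_fun_ifT => //; exact: measurable_fun_eqe.
have sF : (0 < s) = false by rewrite ltNge sn.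
(* The point +oo needs no branch of its own: [fine +oo] is 0 and [powR] sends 0 to 0 for [s != 0],
   which is the value of [epow] there. *)
rewrite (_ : @epow R ^~ s = fun x => if x == 0%E then +oo%E else
    if x == -oo%E then 0%E else (fine x `^ s)%:E); last first.
  apply/funext => x; rewrite /epow (negbTE s0) sF; case: x => [r| |] //=.
  by rewrite powR0.
apply: measurable_fun_ifT => //; first exact: measurable_fun_eqe.
by apply: measurable_fun_ifT => //; exact: measurable_fun_eqe.
Qed.

End epow_theory.

(** * Nonnegative integrals and almost-everywhere relations *)

Section integral_ae.
Context d (T : measurableType d) (R : realType).
Variable mu : {measure set T -> \bar R}.
Implicit Types f g : T -> \bar R.
Local Open Scope ereal_scope.

Lemma ge0_integral_eq0_ae f : measurable_fun setT f -> (forall x, 0 <= f x) ->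
  \int[mu]_x f x = 0 -> {ae mu, forall x, f x = 0}.
Proof.
move=> mf f0 If.
have : \int[mu]_x `|f x| = 0.
  by rewrite -If; apply: eq_integral => x _; rewrite gee0_abs.
move=> /(ae_eq_integral_abs mu measurableT mf); apply: filterS => x; exact.
Qed.

Lemma ge0_integral_lty_ae f : measurable_fun setT f -> (forall x, 0 <= f x) ->
  \int[mu]_x f x < +oo -> {ae mu, forall x, f x < +oo}.
Proof.
move=> mf f0 If.
have intf : mu.-integrable setT f.
  apply/integrableP; split => //; rewrite (le_lt_trans _ If)//.
  by under eq_integral do rewrite gee0_abs//.
have := integrable_ae measurableT intf.
by apply: filterS => x /(_ I) fx; rewrite -ge0_fin_numE.
Qed.

Lemma ge0_eq_integral_ae f g : measurable_fun setT f -> measurable_fun setT g ->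
  (forall x, 0 <= f x) -> (forall x, 0 <= g x) ->
  {ae mu, forall x, f x = g x} -> \int[mu]_x f x = \int[mu]_x g x.
Proof.
move=> mf mg f0 g0 fg; apply: ge0_ae_eq_integral => //.
by apply: filterS fg => x.
Qed.

Lemma ge0_le_integral_ae f g : measurable_fun setT f -> measurable_fun setT g ->
  (forall x, 0 <= f x) -> (forall x, 0 <= g x) ->
  {ae mu, forall x, f x <= g x} -> \int[mu]_x f x <= \int[mu]_x g x.
Proof.
move=> mf mg f0 g0 fg; apply: ae_ge0_le_integral => //.
by apply: filterS fg => x.
Qed.

End integral_ae.

(** * Extremal densities for the duality *)

Section normalised_power.
Context d (T : measurableType d) (R : realType).
Variable mu : {measure set T -> \bar R}.
Variables (h : T -> \bar R) (r M : R).
Hypothesis mh : measurable_fun setT h.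
Hypothesis h0 : forall x, (0 <= h x)%E.
Hypothesis r0 : r != 0.
Hypothesis M0 : 0 < M.
Hypothesis IM : (\int[mu]_x epow (h x) r^-1)%E = M%:E.

(* The extremiser of the duality between h and the densities g with integral 1. *)
Definition npow (x : T) : R := fine (epow (h x) r^-1) / M.

Let mepow : measurable_fun setT (fun x => epow (h x) r^-1).
Proof. exact: measurableT_comp (measurable_epow _) mh. Qed.

Lemma measurable_npow : measurable_fun setT npow.
Proof.
apply: measurable_funM => //.
exact: measurableT_comp (fine_measurable measurableT) mepow.
Qed.

Lemma npow_ge0 x : 0 <= npow x.
Proof. by rewrite divr_ge0 ?fine_ge0 ?epow_ge0// ltW. Qed.

(** [npow] goes through [fine], which sends +oo to 0; finiteness of the integral makes this harmless
    outside a null set. *)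
Lemma epow_lty_ae : {ae mu, forall x, (epow (h x) r^-1 < +oo)%E}.
Proof.
apply: ge0_integral_lty_ae => //; last by rewrite IM ltry.
by move=> x; rewrite epow_ge0.
Qed.

Lemma integral_npow : (\int[mu]_x (npow x)%:E = 1)%E.
Proof.
rewrite (@ge0_eq_integral_ae _ _ _ _ _ (fun x => epow (h x) r^-1 * (M^-1)%:E)%E).
- rewrite ge0_integralZr//; last first.
  + by rewrite lee_fin invr_ge0 ltW.
  + by move=> x _; rewrite epow_ge0.
  by rewrite IM -EFinM divff// gt_eqF.
- by apply/measurable_EFinP; exact: measurable_npow.
- by apply: emeasurable_funM => //.
- by move=> x; rewrite lee_fin npow_ge0.
- by move=> x; rewrite mule_ge0 ?epow_ge0// lee_fin invr_ge0 ltW.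
- apply: filterS epow_lty_ae => x xy.
  by rewrite /npow EFinM fineK// ge0_fin_numE// epow_ge0.
Qed.

(** Since 1 + (1 - r)/r = 1/r, the integrand is almost everywhere h^(1/r) M^(r - 1), whose integral
    is M M^(r - 1). Thus the extremiser attains the value of the norm. *)
Lemma integral_mul_npow : r != 1 ->
  (\int[mu]_x (h x * (npow x `^ (1 - r))%:E) = (M `^ r)%:E)%E.
Proof.
move=> r1.
have e0 : 1 - r != 0 by rewrite subr_eq0 eq_sym.
rewrite (@ge0_eq_integral_ae _ _ _ _ _
  (fun x => epow (h x) r^-1 * (M `^ (r - 1))%:E)%E).
- rewrite ge0_integralZr//; last first.
  + by rewrite lee_fin powR_ge0.
  + by move=> x _; rewrite epow_ge0.
  rewrite IM -EFinM -{1}[M]powRr1 ?ltW// -powRD; last by rewrite (gt_eqF M0) implybT.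
  by rewrite addrC subrK.
- apply: emeasurable_funM => //; apply/measurable_EFinP.
  by apply: measurable_fun_powR; exact: measurable_npow.
- exact: emeasurable_funM.
- by move=> x; rewrite mule_ge0// lee_fin powR_ge0.
- by move=> x; rewrite mule_ge0 ?epow_ge0// lee_fin powR_ge0.
- apply: filterS epow_lty_ae => x; rewrite /npow.
  have := h0 x; case: (h x) => [u| |//].
  + rewrite lee_fin le_eqVlt => /predU1P[<-|u0].
      have [rp|rn|/eqP] := ltgtP 0 r; last by rewrite eq_sym (negbTE r0).
        by rewrite epow0_pos ?invr_gt0// !mul0e.
      by rewrite epow0_neg ?invr_lt0//.
    move=> _; rewrite epow_EFin//= -!EFinM; congr EFin.
    rewrite powRM ?powR_ge0 ?invr_ge0 ?ltW// -powRrM.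
    rewrite -(powR_inv1 (ltW M0)) -powRrM mulN1r opprB mulrA; congr (_ * _).
    rewrite -{1}[u]powRr1 ?ltW// -powRD ?(gt_eqF u0) ?implybT//; congr powR.
    by rewrite mulrBr mulr1 mulVf// addrC subrK.
  + have [rp|rn|/eqP] := ltgtP 0 r; last by rewrite eq_sym (negbTE r0).
      by rewrite epowy_pos ?invr_gt0.
    by rewrite epowy_neg ?invr_lt0// mul0e /= mul0r powR0// mule0.
Qed.

(** A finite nonzero value has a positive power, and for [0 < r] the value +oo is excluded by
    [epow_lty_ae]. This supplies [G_gt0] in the section [key]. *)
Lemma npow_gt0_ae : 0 < r -> {ae mu, forall x, h x != 0%E -> 0 < npow x}.
Proof.
move=> rp; apply: filterS epow_lty_ae => x.
rewrite /npow; have := h0 x; case: (h x) => [u| |//].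
  rewrite lee_fin le_eqVlt => /predU1P[<-|u0]; first by rewrite eqxx.
  by move=> _ _; rewrite divr_gt0// epow_EFin//= powR_gt0.
by rewrite epowy_pos ?invr_gt0.
Qed.

End normalised_power.

(** * Duality for Lnormr *)

(** If every piece of [E] cut out by the exhaustion were null, so would be [E]. The sets [A]
    obtained carry the normalised indicators used as test densities. *)
Lemma sigma_finite_subset d (T : measurableType d) (R : realType)
    (mu : {measure set T -> \bar R}) (E : set T) :
  sigma_finite setT mu -> measurable E -> mu E != 0%E ->
  exists A m, [/\ measurable A, A `<=` E, 0 < m & mu A = m%:E].
Proof.
move=> [F FT mF] mE E0.
have mEF n : measurable (E `&` F n) by apply: measurableI => //; exact: (mF n).1.
have [n EFn] : exists n, mu (E `&` F n) != 0%E.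
  apply: contrapT => /forallNP EF0; move/eqP: E0; apply.
  have [N] : mu.-negligible (\bigcup_n (E `&` F n)).
    apply: negligible_bigcup => n; exists (E `&` F n); split => //.
    by apply/eqP/negPn/negP; exact: EF0.
  rewrite -setI_bigcupr -FT setIT => -[mN N0 EN].
  exact: subset_measure0 EN N0.
exists (E `&` F n), (fine (mu (E `&` F n))).
have EFy : (mu (E `&` F n) < +oo)%E.
  apply: le_lt_trans (mF n).2; apply: le_measure; rewrite ?inE//.
  exact: (mF n).1.
split => //.
- by rewrite fine_gt0// lt0e EFn measure_ge0.
- by rewrite fineK// ge0_fin_numE.
Qed.

Section dual.
Context d (T : measurableType d) (R : realType).
Variable mu : {measure set T -> \bar R}.
Variables (h : T -> \bar R) (r K : R).
Hypothesis mu_fin : sigma_finite setT mu.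
Hypothesis mh : measurable_fun setT h.
Hypothesis h0 : forall x, (0 <= h x)%E.
Hypothesis r1 : r < 1.
Hypothesis dual : forall g : T -> R, measurable_fun setT g ->
  (forall x, 0 <= g x) -> (\int[mu]_x (g x)%:E = 1)%E ->
  (\int[mu]_x (h x * (g x `^ (1 - r))%:E) <= K%:E)%E.

(** The test density is the indicator of [A] divided by [m]. Its power 1 - r is m^(r - 1) on [A] and
    0 elsewhere, because 1 - r is nonzero, so the pairing with [h] is at least a m^(r - 1) m. *)
Lemma dual_test (A : set T) (m : R) (a : \bar R) :
  measurable A -> 0 < m -> mu A = m%:E -> (0 <= a)%E ->
  (forall x, A x -> (a <= h x)%E) -> (a * (m `^ r)%:E <= K%:E)%E.
Proof.
move=> mA m0 Am a0 aA.
have e0 : 1 - r != 0 by rewrite subr_eq0 gt_eqF.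
pose g x : R := \1_A x / m.
have mg : measurable_fun setT g by apply: measurable_funM.
have g0 x : 0 <= g x by rewrite divr_ge0// ltW.
have Ig : (\int[mu]_x (g x)%:E = 1)%E.
  rewrite /g; under eq_integral do rewrite EFinM.
  rewrite ge0_integralZr//.
  - by rewrite integral_indic// setIT Am -EFinM divff// gt_eqF.
  - exact/measurable_EFinP.
  - by rewrite lee_fin invr_ge0 ltW.
apply: le_trans (dual mg g0 Ig).
have gE x : g x `^ (1 - r) = m `^ (r - 1) * \1_A x.
  rewrite /g indicE; case: (x \in A); last by rewrite mul0r powR0// mulr0.
  by rewrite mul1r mulr1 -(powR_inv1 (ltW m0)) -powRrM mulN1r opprB.
apply: (@le_trans _ _ (\int[mu]_x (a * (m `^ (r - 1))%:E * (\1_A x)%:E))%E).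
  rewrite ge0_integralZl//.
  - rewrite integral_indic// setIT Am -muleA -EFinM lee_wpmul2l// lee_fin.
    by rewrite -[X in _ * X](powRr1 (ltW m0)) -powRD ?(gt_eqF m0) ?implybT// subrK.
  - exact/measurable_EFinP.
  - by rewrite mule_ge0// lee_fin powR_ge0.
apply: ge0_le_integral => //.
- by move=> x _; rewrite !mule_ge0// lee_fin ?powR_ge0.
- by apply: emeasurable_funM => //; exact/measurable_EFinP.
- apply: emeasurable_funM => //; apply/measurable_EFinP.
  exact: measurable_fun_powR.
move=> x _; rewrite gE EFinM -muleA.
have [xA|xA] := boolP (x \in A); last by rewrite indicE (negbTE xA) !mule0.
by apply: lee_wpmul2r; [rewrite mule_ge0// lee_fin powR_ge0|apply: aA; exact/set_mem].
Qed.

(** Otherwise [dual_test] fails on a subset of finite positive mass; that mass is not under control,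
    hence the quantification over [m]. *)
Lemma dual_null (E : set T) (a : \bar R) : measurable E -> (0 <= a)%E ->
  (forall x, E x -> (a <= h x)%E) ->
  (forall m, 0 < m -> (K%:E < a * (m `^ r)%:E)%E) -> mu E = 0%E.
Proof.
move=> mE a0 aE aK; apply/eqP/negPn/negP.
move=> /(sigma_finite_subset mu_fin mE)[A [m [mA AE m0 Am]]].
have := dual_test mA m0 Am a0 (fun x Ax => aE _ (AE _ Ax)).
by apply/negP; rewrite -ltNge aK.
Qed.

Lemma dual_y_null : mu [set x | h x = +oo%E] = 0%E.
Proof.
apply: (@dual_null _ +oo%E) => //.
- by rewrite -[X in measurable X]setTI; apply: measurable_eqe => //.
- by move=> x /= ->.
- by move=> m m0; rewrite gt0_mulye ?ltry// lte_fin powR_gt0.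
Qed.

Lemma dual_y_ae : {ae mu, forall x, (h x < +oo)%E}.
Proof.
exists [set x | h x = +oo%E]; split => //.
- by rewrite -[X in measurable X]setTI; apply: measurable_eqe => //.
- exact: dual_y_null.
- by move=> x /= /negP; rewrite -leNgt leye_eq => /eqP.
Qed.

Lemma dual_ess_sup : r = 0 -> 0 <= K ->
  forall K', K < K' -> mu [set x | (K'%:E < h x)%E] = 0%E.
Proof.
move=> rE K0 K' KK'; apply: (@dual_null _ K'%:E) => //.
- by rewrite -[X in measurable X]setTI; apply: measurable_lte.
- by rewrite lee_fin (le_trans K0)// ltW.
- by move=> x /= /ltW.
- by move=> m m0; rewrite rE powRr0 mule1 lte_fin.
Qed.

(** An infinite integral has negative power 0, and a finite positive one makes [npow] an admissible
    density attaining the bound. A zero integral would force [h] to be +oo almost everywhere,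
    against [dual_y_ae] on a space of nonzero mass. *)
Lemma dual_neg : r < 0 -> mu setT != 0%E ->
  (epow (\int[mu]_x epow (h x) r^-1) r <= K%:E)%E.
Proof.
move=> rn muT.
have IM0 : (0 <= \int[mu]_x epow (h x) r^-1)%E.
  by apply: integral_ge0 => x _; exact: epow_ge0.
have K0 : (0 <= K%:E)%E.
  have [A [m [mA _ m0 Am]]] := sigma_finite_subset mu_fin measurableT muT.
  apply: le_trans (dual_test mA m0 Am (lexx 0%E) (fun x _ => h0 x)).
  by rewrite mul0e.
case IM : (\int[mu]_x epow (h x) r^-1)%E => [M| |].
- move: IM0; rewrite IM lee_fin le_eqVlt => /predU1P[M0|M0].
    exfalso; move/eqP: muT; apply.
    have ae0 : {ae mu, forall x, epow (h x) r^-1 = 0%E}.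
      apply: ge0_integral_eq0_ae.
      - exact: measurableT_comp (measurable_epow _) mh.
      - by move=> x; exact: epow_ge0.
      - by rewrite IM -M0.
    have [N [mN N0 NT]] : {ae mu, forall x : T, False}.
      apply: filterS2 ae0 dual_y_ae => x.
      have := h0 x; case: (h x) => [u| |]//; rewrite lee_fin le_eqVlt.
      move=> /predU1P[<-|u0]; first by rewrite epow0_neg ?invr_lt0.
      by rewrite epow_EFin// => -[] /eqP; rewrite gt_eqF ?powR_gt0.
    by apply: subset_measure0 N0 => // x _; apply: NT => /=.
  rewrite epow_EFin// -(@integral_mul_npow _ _ _ mu h r M)//; last 2 first.
  + by rewrite lt_eqF.
  + by rewrite lt_eqF.
  apply: dual.
  + exact: measurable_npow.
  + by move=> x; exact: npow_ge0.
  + by apply: integral_npow; rewrite // lt_eqF.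
- by rewrite epowy_neg.
- by move: IM0; rewrite IM.
Qed.

(* The extremiser is only available after truncating h to sets of finite measure
   where it is bounded; these exhaust a set of full measure by dual_y_ae. *)
Lemma dual_pos : 0 < r -> 0 <= K ->
  (epow (\int[mu]_x epow (h x) r^-1) r <= K%:E)%E.
Proof.
move=> rp K0.
have ri : 0 < r^-1 by rewrite invr_gt0.
pose u x := epow (h x) r^-1.
have mu_ : measurable_fun setT u by exact: measurableT_comp (measurable_epow _) mh.
have u0 x : (0 <= u x)%E by exact: epow_ge0.
suff uK : (\int[mu]_x u x <= (K `^ r^-1)%:E)%E.
  have : (0 <= \int[mu]_x u x)%E by exact: integral_ge0.
  rewrite -/u; move: uK; case: (\int[mu]_x u x)%E => [M| |]//.
  rewrite !lee_fin => MK M0; rewrite epow_EFin_pos// lee_fin.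
  rewrite -[leRHS]powRr1// -(mulVf (lt0r_neq0 rp)) powRrM.
  by rewrite ge0_ler_powR ?nnegrE ?powR_ge0// ltW.
have /sigma_finiteP[F [FT ndF mF]] := mu_fin.
pose E n := F n `&` [set x | (h x <= n%:R%:E)%E].
have mE n : measurable (E n).
  apply: measurableI; first exact: (mF n).1.
  by rewrite -[X in measurable X]setTI; apply: measurable_lee.
have ndE : {homo E : n m / (n <= m)%N >-> (n <= m)%O}.
  move=> n m nm; apply/subsetPset => x [Fx hx]; split.
    by move/subsetPset : (ndF _ _ nm); exact.
  by apply: le_trans hx _; rewrite lee_fin ler_nat.
have -> : (\int[mu]_x u x = \int[mu]_(x in \bigcup_n E n) u x)%E.
  have mUE : measurable (\bigcup_n E n) by exact: bigcup_measurable.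
  rewrite [RHS]integral_mkcond; apply: ge0_eq_integral_ae => //.
  - by apply/(measurable_restrictT _ _).1 => //; exact: measurable_funS mu_.
  - by move=> x; apply: erestrict_ge0.
  apply: filterS dual_y_ae => x hxy.
  rewrite patchE ifT//; apply/mem_set.
  have hfin : h x \is a fin_num by rewrite ge0_fin_numE.
  have : [set: T] x by []; rewrite FT => -[i _ Fi].
  exists (maxn i (Num.truncn (fine (h x))).+1) => //; split.
    by move/subsetPset : (ndF _ _ (leq_maxl i (Num.truncn (fine (h x))).+1)); exact.
  rewrite /= -(fineK hfin) lee_fin (le_trans (ltW (truncnS_gt _)))// ler_nat.
  exact: leq_maxr.
have cvg := @ge0_nondecreasing_set_cvg_integral _ _ _ E u mu ndE mE
  (fun i => measurable_funS measurableT (@subsetT _ _) mu_) (fun _ x _ => u0 x).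
rewrite -(cvg_lim _ cvg)//; apply: lime_le; first by apply/cvg_ex; eexists; exact: cvg.
apply: nearW => n.
pose hn := h \_ (E n).
have hn0 x : (0 <= hn x)%E by exact: erestrict_ge0.
have mhn : measurable_fun setT hn.
  by apply/(measurable_restrictT _ _).1 => //; exact: measurable_funS mh.
have hnE : (\int[mu]_(x in E n) u x = \int[mu]_x epow (hn x) r^-1)%E.
  rewrite integral_mkcond; apply: eq_integral => x _.
  by rewrite /hn !patchE; case: ifP => // _; rewrite epow0_pos.
have hn_le x : (hn x <= h x)%E by rewrite /hn patchE; case: ifP.
have finE : (\int[mu]_(x in E n) u x < +oo)%E.
  apply: (@le_lt_trans _ _ (\int[mu]_(x in E n) cst ((n%:R `^ r^-1)%:E) x)%E).
    apply: ge0_le_integral => //; first exact: measurable_funS mu_.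
    move=> x [_] /=; rewrite /u; have := h0 x; case: (h x) => [t| |]//.
    rewrite !lee_fin => t0 tn; rewrite epow_EFin_pos// lee_fin.
    by rewrite ge0_ler_powR ?nnegrE// ltW.
  rewrite integral_cst// lte_mul_pinfty ?lee_fin ?powR_ge0//.
  apply: le_lt_trans (mF n).2; apply: le_measure; rewrite ?inE//.
    exact: (mF n).1.
  by move=> x [].
have IM0 : (0 <= \int[mu]_(x in E n) u x)%E by exact: integral_ge0.
move: finE IM0; rewrite hnE; case IM : (\int[mu]_x epow (hn x) r^-1)%E => [M| |]// _.
rewrite !lee_fin le_eqVlt => /predU1P[<-|M0]; first exact: powR_ge0.
(* The extremiser of [hn] is tested against [h]: its pairing with [hn] is exactly M^r, and [hn_le]
   compares this with the pairing bounded by [dual]. *)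
have MK : M `^ r <= K.
  rewrite -lee_fin -(@integral_mul_npow _ _ _ mu hn r M)//; last 2 first.
  - by rewrite gt_eqF.
  - by rewrite lt_eqF.
  have mn := measurable_npow r M mhn.
  have n0 := npow_ge0 hn r M0.
  apply: le_trans (dual mn _ _).
  - apply: ge0_le_integral => //.
    + by move=> x _; rewrite mule_ge0// lee_fin powR_ge0.
    + apply: emeasurable_funM => //; apply/measurable_EFinP.
      exact: measurable_fun_powR.
    + apply: emeasurable_funM => //; apply/measurable_EFinP.
      exact: measurable_fun_powR.
    + by move=> x _; rewrite lee_wpmul2r// lee_fin powR_ge0.
  - by [].
  - by apply: integral_npow; rewrite // gt_eqF.
rewrite -[leLHS](powRr1 (ltW M0)) -(mulfV (lt0r_neq0 rp)) powRrM.
by rewrite ge0_ler_powR ?nnegrE ?powR_ge0// ltW.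
Qed.

End dual.

Lemma Lnormr_le_dual (R : realType) (n : nat) (h : n.-tuple R -> \bar R)
    (r K : R) :
  measurable_fun setT h -> (forall x, 0 <= h x)%E -> r < 1 -> 0 <= K ->
  (forall g : n.-tuple R -> R, measurable_fun setT g ->
    (forall x, 0 <= g x) -> (\int[@leb R n]_x (g x)%:E = 1)%E ->
    (\int[@leb R n]_x (h x * (g x `^ (1 - r))%:E) <= K%:E)%E) ->
  (Lnormr r h <= K%:E)%E.
Proof.
move=> mh h0 r1 K0 dual; rewrite /Lnormr.
have leb_fin : sigma_finite setT (@leb R n) by exact: sigma_finiteT.
have [rE|rn] := eqVneq r 0.
  (* Each K + e with e > 0 is an essential upper bound of [h], so the infimum is at most K. *)
  apply/lee_addgt0Pr => e e0; apply: ereal_inf_lbound => /=.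
  rewrite -EFinD.
  apply: (@dual_ess_sup _ _ _ (@leb R n) h r K) => //.
  by rewrite ltrDl.
have [rp|rneg] := ltP 0 r; first exact: (@dual_pos _ _ _ (@leb R n)).
apply: (@dual_neg _ _ _ (@leb R n)) => //; first by rewrite lt_neqAle rn.
by rewrite gt_eqF// leb_setT_gt0.
Qed.

(** * The Brascamp-Lieb constant *)

(** The exponential lies above its tangent at the mean [m], and averaging removes the linear term of
    that tangent. *)
Lemma expR_jensen (R : realType) (I : finType) (w l : I -> R) :
  (forall i, 0 <= w i) -> \sum_i w i = 1 ->
  expR (\sum_i w i * l i) <= \sum_i w i * expR (l i).
Proof.
move=> w0 w1; set m := \sum_i w i * l i.
have -> : expR m = \sum_i w i * (expR m * (1 + (l i - m))).
  under eq_bigr do rewrite mulrCA.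
  rewrite -mulr_sumr.
  under eq_bigr do rewrite mulrDr mulr1 mulrBr.
  by rewrite big_split/= w1 sumrB -/m -mulr_suml w1 mul1r subrr addr0 mulr1.
apply: ler_sum => i _; rewrite ler_wpM2l// -{2}[l i](subrK m) addrC expRD.
by rewrite addrC mulrC ler_wpM2r ?expR_ge0// expR_ge1Dx.
Qed.

Section BLconst_theory.
Context (R : realType) (d k : nat) (dims : 'I_k -> nat).
Variables (B : forall i : 'I_k, 'M[R]_(dims i, d)) (c : 'I_k -> R).

Lemma measurable_BLprod (fs : forall i, (dims i).-tuple R -> R) :
  (forall i, measurable_fun setT (fs i)) ->
  measurable_fun setT
    (fun x : d.-tuple R => \prod_(i < k) fs i (linmap (B i) x) `^ c i).
Proof.
move=> mfs; apply: measurable_prod => i _; apply: measurable_fun_powR.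
exact: measurableT_comp (mfs i) (measurable_linmap (B i)).
Qed.

(** For inputs of integral 1 the product on the right is 1, so every admissible [C] bounds the left
    side and the infimum does too. *)
Lemma le_BLconst (fs : forall i, (dims i).-tuple R -> R) :
  (forall i, measurable_fun setT (fs i)) -> (forall i y, 0 <= fs i y) ->
  (forall i, \int[@leb R (dims i)]_y (fs i y)%:E = 1)%E ->
  (\int[@leb R d]_x (\prod_(i < k) fs i (linmap (B i) x) `^ c i)%:E
    <= BLconst B c)%E.
Proof.
move=> mfs fs0 Ifs; apply: le_ereal_inf_tmp => C [C0 /(_ fs mfs fs0)].
move=> /(_ _)/le_trans; apply; first by move=> i; rewrite Ifs ltry.
rewrite big1 ?mule1// => i _.
by rewrite Ifs epow_EFin// powR1.
Qed.

(* Excludes the case where epow (BLconst B c) (p^-1 - 1) is +oo. *)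
Lemma BLconst_gt0 : (forall i, 0 < c i) -> (0 < BLconst B c)%E.
Proof.
move=> c0; rewrite ltNge; apply/negP => BL0.
have exF i : exists F, [/\ [set: (dims i).-tuple R] = \bigcup_n F n,
    nondecreasing_seq F &
    forall n, measurable (F n) /\ (@leb R (dims i) (F n) < +oo)%E].
  exact/sigma_finiteP/sigma_finiteT.
pose F i := sval (cid (exF i)).
have FP i := svalP (cid (exF i)).
(* These preimages of sets of finite measure exhaust the source, so one contains a set [A] of
   positive mass. On [A] all the indicators composed with the maps equal 1. *)
pose E n := \bigcap_(i in [set: 'I_k]) (@linmap R _ _ (B i) @^-1` F i n).
have mE n : measurable (E n).
  apply: fin_bigcap_measurable => // i _; rewrite -[X in measurable X]setTI.
  by apply: measurable_linmap => //; have [_ _ /(_ n)[]] := FP i.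
have UE : [set: d.-tuple R] = \bigcup_n E n.
  apply/seteqP; split => // x _.
  have exn i : exists n, F i n (linmap (B i) x).
    have [FT _ _] := FP i.
    have : [set: (dims i).-tuple R] (linmap (B i) x) by [].
    by rewrite FT => -[n _ ?]; exists n.
  have [nn nnP] := choice exn.
  exists (\max_(i < k) nn i)%N => // i _ /=.
  have [_ ndF _] := FP i.
  have /subsetPset := ndF _ _ (leq_bigmax i : nn i <= _)%N.
  by apply; exact: nnP.
have [n En0] : exists n, @leb R d (E n) != 0%E.
  apply: contrapT => /forallNP EF0.
  have [N [mN N0 EN]] : (@leb R d).-negligible (\bigcup_n E n).
    apply: negligible_bigcup => n; exists (E n); split => //.
    by apply/eqP/negPn/negP; exact: EF0.
  rewrite -UE in EN.
  have T0 : @leb R d setT = 0%E by exact: subset_measure0 EN N0.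
  by have := leb_setT_gt0 R d; rewrite T0 ltxx.
have [A [m [mA AE m0 Am]]] := sigma_finite_subset (sigma_finiteT _) (mE n) En0.
pose fs i (y : (dims i).-tuple R) : R := \1_(F i n) y.
have mF i : measurable (F i n) by have [_ _ /(_ n)[]] := FP i.
have mfs i : measurable_fun setT (fs i) by exact: (measurable_indic (mF i)).
have fs0 i y : 0 <= fs i y by rewrite /fs indicE.
have Ifs i : (\int[@leb R (dims i)]_y (fs i y)%:E = @leb R (dims i) (F i n))%E.
  by rewrite integral_indic ?setIT//; exact: mF.
have Ify i : (@leb R (dims i) (F i n) < +oo)%E by have [_ _ /(_ n)[]] := FP i.
pose q := \prod_(i < k) fine (@leb R (dims i) (F i n)) `^ c i.
have q0 : 0 <= q by apply: prodr_ge0 => i _; exact: powR_ge0.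
have qE : (\prod_(i < k) epow (\int[@leb R (dims i)]_y (fs i y)%:E) (c i) = q%:E)%E.
  rewrite /q -prodEFin; apply: eq_bigr => i _.
  by rewrite Ifs -epow_EFin_pos// fineK// ge0_fin_numE.
have lb : (m%:E <= \int[@leb R d]_x
    (\prod_(i < k) fs i (linmap (B i) x) `^ c i)%:E)%E.
  rewrite -Am -[A]setIT -integral_indic//; apply: ge0_le_integral => //.
  - by apply/measurable_EFinP; exact: (measurable_indic mA).
  - by apply/measurable_EFinP; exact: measurable_BLprod.
  - move=> x _; rewrite lee_fin indicE.
    have [/set_mem xA|_] := boolP (x \in A); last first.
      by apply: prodr_ge0 => i _; exact: powR_ge0.
    rewrite big1// => i _; rewrite /fs indicE mem_set ?powR1//.
    exact: (AE _ xA).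
(* An admissible C below m/(q + 1) gives m <= C q <= C (q + 1) < m. The added 1 keeps the
   denominator positive when [q] is 0. *)
have qm : (BLconst B c < (m / (q + 1))%:E)%E.
  by apply: le_lt_trans BL0 _; rewrite lte_fin divr_gt0// ltr_wpDl.
have [C [C0 CP] Cm] := ereal_inf_lt qm.
have := CP fs mfs fs0.
rewrite qE; move=> /(_ _)/(le_trans lb) h.
have {h} : (m%:E <= C * q%:E)%E by apply: h => i; rewrite Ifs.
move: C0 Cm; case: C CP => [C| |]// _; rewrite !lee_fin lte_fin => C0 Cm.
rewrite ltr_pdivlMr ?ltr_wpDl// in Cm; apply/negP; rewrite -ltNge.
by apply: le_lt_trans Cm; rewrite ler_wpM2l// lerDl.
Qed.

End BLconst_theory.

(** * The reverse Hoelder estimate *)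

(** The pushforward identity is tested on the indicator of [Z]: the left integral vanishes, hence so
    does the right one. Preimages of null sets are thus controlled only where [f] is nonzero. *)
Lemma pushforward_ae (R : realType) (m n : nat) (B : 'M[R]_(m, n))
    (f : n.-tuple R -> R) (g : m.-tuple R -> \bar R) (Z : set (m.-tuple R)) :
  measurable_fun setT f -> (forall x, 0 <= f x) -> is_pushforward B f g ->
  measurable Z -> {ae @leb R m, forall y, g y != 0%E -> ~ Z y} ->
  {ae @leb R n, forall x, f x != 0 -> ~ Z (linmap B x)}.
Proof.
move=> mf f0 [mg g0 pf] mZ gZ.
have mI : measurable_fun setT (\1_Z : m.-tuple R -> R).
  exact: (measurable_indic mZ).
have I0 y : 0 <= (\1_Z : m.-tuple R -> R) y by rewrite indicE.
have gI0 : (\int[@leb R m]_y (g y * (\1_Z y)%:E) = 0)%E.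
  rewrite (@ge0_eq_integral_ae _ _ _ (@leb R m) _ (cst 0%E)) ?integral0//.
  - by apply: emeasurable_funM => //; exact/measurable_EFinP.
  - by move=> y; rewrite mule_ge0// lee_fin.
  - apply: filterS gZ => y gZy; rewrite /= indicE.
    have [->|/gZy Zy] := eqVneq (g y) 0%E; first by rewrite mul0e.
    by rewrite memNset// mule0.
rewrite (pf _ mI I0) in gI0.
have : {ae @leb R n, forall x, (f x * \1_Z (linmap B x))%:E = 0%E}.
  apply: ge0_integral_eq0_ae gI0.
  - apply/measurable_EFinP; apply: measurable_funM => //.
    exact: measurableT_comp mI (measurable_linmap B).
  - by move=> x; rewrite lee_fin mulr_ge0.
apply: filterS => x [] /eqP; rewrite mulf_eq0 => /orP[->//|+] _ Zx.
by rewrite indicE mem_set// oner_eq0.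
Qed.

Section key.
Context (R : realType) (d k : nat) (dims : 'I_k -> nat).
Variables (B : forall i : 'I_k, 'M[R]_(dims i, d)) (c : 'I_k -> R).
Variables (p : R) (theta : 'I_k -> R) (f : d.-tuple R -> R).
Variables (Bf : forall i : 'I_k, (dims i).-tuple R -> \bar R) (i0 : 'I_k).
Hypothesis c0 : forall i, 0 < c i.
Hypothesis p1 : 1 < p.
Hypothesis th0 : 0 < theta i0.
Hypothesis thn : forall i, i != i0 -> theta i < 0.
Hypothesis th1 : \sum_(i < k) theta i = 1.
Hypothesis mf : measurable_fun setT f.
Hypothesis f0 : forall x, 0 <= f x.
Hypothesis pf : forall i, is_pushforward (B i) f (@Bf i).

Variables (A bl : R) (N : 'I_k -> R) (G : forall i, (dims i).-tuple R -> R).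
Hypothesis A0 : 0 < A.
Hypothesis IA : (\int[@leb R d]_x (f x `^ p)%:E = A%:E)%E.
Hypothesis blE : BLconst B c = bl%:E.
Hypothesis bl0 : 0 < bl.
Hypothesis N0 : forall i, i != i0 -> 0 < N i.
Hypothesis mG : forall i, measurable_fun setT (@G i).
Hypothesis G0 : forall i y, 0 <= @G i y.
Hypothesis IG : forall i, (\int[@leb R (dims i)]_y (G y)%:E = 1)%E.
Hypothesis IBG : forall i, i != i0 ->
  (\int[@leb R (dims i)]_y
     (Bf y * (G y `^ (c i * (1 - p^-1) / theta i))%:E) <= (N i)%:E)%E.
Hypothesis G_gt0 : forall i, i != i0 ->
  {ae @leb R (dims i), forall y, @Bf i y != 0%E -> 0 < G y}.

Let s := 1 - p^-1.
Let e i := c i * s / theta i.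
Let Phi (x : d.-tuple R) := \prod_(i < k) @G i (linmap (B i) x) `^ c i.

(* In the notation of the header, ln K. *)
Definition holder_log : R := (theta i0)^-1 *
  (p^-1 * ln A + s * ln bl - \sum_(i | i != i0) theta i * ln (N i)).

(** The Hoelder weights, and the factors normalised to have integral at most 1. At [i0] the product
    of f and Phi^s is replaced by a convex combination of f^p and Phi, both normalised, which
    dominates it up to a constant because 1/p + s = 1. *)
Let w i : R := if i == i0 then (theta i0)^-1 else - theta i / theta i0.
Let t i (x : d.-tuple R) : R :=
  if i == i0 then p^-1 * (f x `^ p / A) + s * (Phi x / bl)
  else f x * G (linmap (B i) x) `^ e i / N i.

Let p0 : 0 < p. Proof. exact: lt_trans p1. Qed.

Let s0 : 0 < s. Proof. by rewrite subr_gt0 invf_lt1. Qed.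

Let w0 i : 0 <= w i.
Proof.
rewrite /w; have [_|/thn/ltW ti] := eqVneq i i0; first by rewrite invr_ge0 ltW.
by rewrite divr_ge0 ?oppr_ge0// ltW.
Qed.

Let sum_thn : \sum_(i < k | i != i0) theta i = 1 - theta i0.
Proof. by rewrite -th1 [in RHS](bigD1 i0)//= addrAC subrr add0r. Qed.

Let w1 : \sum_i w i = 1.
Proof.
rewrite (bigD1 i0)//= [w i0]/w eqxx.
rewrite (eq_bigr (fun i => theta i * - (theta i0)^-1)); last first.
  by move=> i ii0; rewrite /w (negbTE ii0) mulNr mulrN.
rewrite -mulr_suml sum_thn; field.
exact: lt0r_neq0.
Qed.

Let Phi0 x : 0 <= Phi x.
Proof. by apply: prodr_ge0 => i _; exact: powR_ge0. Qed.

Let t0 i x : 0 <= t i x.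
Proof.
rewrite /t; have [_|/N0/ltW Ni] := eqVneq i i0.
  by rewrite addr_ge0// mulr_ge0 ?divr_ge0 ?invr_ge0 ?powR_ge0//; exact: ltW.
by rewrite divr_ge0// mulr_ge0 ?powR_ge0.
Qed.

Let mGB i : measurable_fun setT (fun x => G (linmap (B i) x) `^ e i).
Proof.
apply: measurable_fun_powR.
apply: measurableT_comp; [exact: mG|exact: measurable_linmap].
Qed.

Let mt i : measurable_fun setT (t i).
Proof.
rewrite /t; have [_|_] := eqVneq i i0.
  apply: measurable_funD; apply: measurable_funM => //; apply: measurable_funM => //.
    exact: measurable_fun_powR.
  exact: measurable_BLprod.
by apply: measurable_funM => //; apply: measurable_funM.
Qed.

(** At [i0] the Brascamp-Lieb inequality bounds the part with [Phi] by s, and the part with f^p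
    gives 1/p. At the other indices the pushforward identity reduces the integral to [IBG]. *)
Let int_t i : (\int[@leb R d]_x (t i x)%:E <= 1)%E.
Proof.
rewrite /t; have [ii0|ii0] := eqVneq i i0.
  under eq_integral do rewrite EFinD.
  have m1 : measurable_fun setT (fun x : d.-tuple R => (f x `^ p)%:E).
    by apply/measurable_EFinP; exact: measurable_fun_powR.
  have m2 : measurable_fun setT (fun x => (Phi x)%:E).
    by apply/measurable_EFinP; exact: measurable_BLprod.
  rewrite (_ : 1%E = (p^-1)%:E + s%:E)%E; last first.
    by rewrite -EFinD /s addrC subrK.
  have E1 : (\int[@leb R d]_x (p^-1 * (f x `^ p / A))%:E = (p^-1)%:E)%E.
    rewrite (_ : (fun _ => _) = fun x : d.-tuple R =>
      ((p^-1 / A)%:E * (f x `^ p)%:E)%E).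
      rewrite ge0_integralZl//.
      - by rewrite IA -EFinM divfK// gt_eqF.
      - by move=> x _; rewrite lee_fin powR_ge0.
      - by rewrite lee_fin divr_ge0// ?invr_ge0 ltW.
    by apply/funext => x; rewrite -EFinM; congr EFin; ring.
  have E2 : (\int[@leb R d]_x (s * (Phi x / bl))%:E <= s%:E)%E.
    rewrite (_ : (fun _ => _) = fun x : d.-tuple R =>
      ((s / bl)%:E * (Phi x)%:E)%E).
      rewrite ge0_integralZl//.
      - have := le_BLconst B c mG G0 IG; rewrite blE => le.
        rewrite (_ : s%:E = (s / bl)%:E * bl%:E)%E; last first.
          by rewrite -EFinM divfK// gt_eqF.
        by rewrite lee_wpmul2l// lee_fin divr_ge0// ltW.
      - by move=> x _; rewrite lee_fin.
      - by rewrite lee_fin divr_ge0// ltW.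
    by apply/funext => x; rewrite -EFinM; congr EFin; ring.
  rewrite ge0_integralD//.
  - by rewrite E1 leeD2l.
  - by move=> x _; rewrite lee_fin mulr_ge0 ?invr_ge0 ?divr_ge0 ?powR_ge0//; exact: ltW.
  - by apply/measurable_EFinP; do 2 apply: measurable_funM => //; exact/measurable_EFinP.
  - by move=> x _; rewrite lee_fin mulr_ge0 ?divr_ge0//; exact: ltW.
  - by apply/measurable_EFinP; do 2 apply: measurable_funM => //; exact/measurable_EFinP.
have Ni := N0 ii0.
under eq_integral do rewrite EFinM.
rewrite ge0_integralZr//.
- have mGe : measurable_fun setT (fun y => @G i y `^ e i).
    by apply: measurable_fun_powR; exact: mG.
  have [_ _ /(_ _ mGe (fun y => powR_ge0 _ _)) <-] := pf i.
  by rewrite lee_pdivrMr// mul1e IBG.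
- by apply/measurable_EFinP; exact: measurable_funM.
- by move=> x _; rewrite lee_fin mulr_ge0// powR_ge0.
- by rewrite lee_fin invr_ge0 ltW.
Qed.

(** For [i != i0] the exponent [e i] is negative, and [powR] sends 0 to 0 there. The cancellation of
    powers of [G] in [pointwise] therefore needs positivity. *)
Let G_pos : {ae @leb R d, forall x i, i != i0 -> f x != 0 ->
  0 < G (linmap (B i) x)}.
Proof.
apply: filter_forall => i.
have [->|ii0] := eqVneq i i0; first exact: nearW.
have mZ : measurable [set y | @G i y = 0].
  rewrite -[X in measurable X]setTI.
  exact: (@mG i measurableT _ (measurable_set1 0)).
have := pushforward_ae mf f0 (pf i) mZ.
move=> /(_ _)/filterS; apply => //.
- move=> x fx _ /fx; move=> /eqP.
  by rewrite lt0r G0 andbT.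
- by apply: filterS (G_gt0 ii0) => y + /[swap] /= Gy => /[apply]; rewrite Gy ltxx.
Qed.

(* Weighted AM-GM as Jensen for expR at the logarithms l i: in the exponent the
   terms ln (G i) cancel for i != i0. *)
Let pointwise x : (forall i, i != i0 -> f x != 0 -> 0 < G (linmap (B i) x)) ->
  f x * G (linmap (B i0) x) `^ e i0 <= expR holder_log * \sum_i w i * t i x.
Proof.
move=> Gx.
have rhs0 : 0 <= expR holder_log * \sum_i w i * t i x.
  by rewrite mulr_ge0 ?expR_ge0// sumr_ge0// => i _; rewrite mulr_ge0.
have [->|fx] := eqVneq (f x) 0; first by rewrite mul0r.
have e0 : e i0 != 0 by rewrite lt0r_neq0// divr_gt0// mulr_gt0.
have [->|gx] := eqVneq (G (linmap (B i0) x)) 0; first by rewrite powR0// mulr0.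
have fx0 : 0 < f x by rewrite lt0r fx f0.
have Gx0 i : 0 < G (linmap (B i) x).
  by have [->|/Gx] := eqVneq i i0; [rewrite lt0r gx G0|exact].
pose u := ln (f x); pose h i := ln (G (linmap (B i) x)).
pose l i := if i == i0 then
    p^-1 * (p * u - ln A) + s * (\sum_j c j * h j - ln bl)
  else u + e i * h i - ln (N i).
have fE : f x = expR u by rewrite lnK.
have GE i r : G (linmap (B i) x) `^ r = expR (r * h i).
  by rewrite /powR gt_eqF.
have lt_ i : expR (l i) <= t i x.
  rewrite /l /t; have [_|ii0] := eqVneq i i0.
    (* A two-point Jensen inequality with weights 1/p and s, matching the convex combination in
       [t i0]. *)
    have := @expR_jensen R bool (fun b => if b then p^-1 else s)
      (fun b => if b then p * u - ln A else \sum_j c j * h j - ln bl).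
    rewrite !big_bool /= => /(_ _ _)/le_trans; apply.
    - by case; rewrite ?invr_ge0 ltW.
    - by rewrite /s addrC subrK.
    - rewrite !expRD !expRN !lnK// /Phi.
      rewrite (eq_bigr _ (fun i _ => GE i (c i))) -expR_sum.
      by rewrite /powR gt_eqF.
  rewrite !expRD expRN lnK ?posrE ?N0//.
  by rewrite GE -fE.
have -> : f x * G (linmap (B i0) x) `^ e i0 =
    expR holder_log * expR (\sum_i w i * l i).
  rewrite GE fE -!expRD; congr expR.
  (* Here w_i e_i = -c_i s/theta_0, opposite to the exponent of G_i coming from [Phi]; only c_0
     s/theta_0 survives, and the powers of f combine to 1. *)
  have E : \sum_(i < k | i != i0) w i * l i = - (u / theta i0) * (1 - theta i0) -
      s / theta i0 * (\sum_(i < k | i != i0) c i * h i) +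
      (theta i0)^-1 * (\sum_(i < k | i != i0) theta i * ln (N i)).
    rewrite -sum_thn !mulr_sumr -sumrB -big_split/=; apply: eq_bigr => i ii0.
    rewrite /w /l /e (negbTE ii0); field.
    by rewrite lt0r_neq0//= ltr0_neq0// thn.
  rewrite (bigD1 i0)//= E /holder_log /w /l eqxx [in \sum_j _](bigD1 i0)//= /e.
  by field; rewrite !lt0r_neq0.
rewrite ler_wpM2l ?expR_ge0//.
apply: le_trans (expR_jensen _ w0 w1) _.
by apply: ler_sum => i _; rewrite ler_wpM2l.
Qed.

(** The pushforward identity moves the integral to the source, where [pointwise] applies; a
    combination of the [t i] with weights of sum 1 has integral at most 1. *)
Lemma reverse_holder :
  (\int[@leb R (dims i0)]_y
     (Bf y * (G y `^ (c i0 * (1 - p^-1) / theta i0))%:E)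
   <= (expR holder_log)%:E)%E.
Proof.
have mGe : measurable_fun setT (fun y => @G i0 y `^ e i0).
  by apply: measurable_fun_powR; exact: mG.
have [_ _ /(_ _ mGe (fun y => powR_ge0 _ _)) ->] := pf i0.
have msum : measurable_fun setT (fun x => \sum_i w i * t i x).
  by apply: measurable_sum => i; apply: measurable_funM.
apply: (@le_trans _ _
    (\int[@leb R d]_x (expR holder_log * \sum_i w i * t i x)%:E)%E).
  apply: ge0_le_integral_ae.
  - by apply/measurable_EFinP; exact: measurable_funM.
  - by apply/measurable_EFinP; exact: measurable_funM.
  - by move=> x; rewrite lee_fin mulr_ge0// powR_ge0.
  - move=> x; rewrite lee_fin mulr_ge0 ?expR_ge0// sumr_ge0// => i _.
    by rewrite mulr_ge0.
  - by apply: filterS G_pos => x /pointwise; rewrite lee_fin.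
under eq_integral do rewrite EFinM -sumEFin.
rewrite ge0_integralZl//; last 2 first.
- by under eq_fun do rewrite sumEFin; exact/measurable_EFinP.
- by move=> x _; apply: sume_ge0 => i _; rewrite lee_fin mulr_ge0.
rewrite -[leRHS]mule1 lee_wpmul2l ?lee_fin ?expR_ge0//.
rewrite ge0_integral_sum//; last 2 first.
- by move=> i; apply/measurable_EFinP; exact: measurable_funM.
- by move=> i x _; rewrite lee_fin mulr_ge0.
rewrite -w1 -sumEFin; apply: lee_sum => i _.
under eq_integral do rewrite EFinM.
rewrite ge0_integralZl//.
- by rewrite -[leRHS]mule1 lee_wpmul2l// lee_fin.
- exact/measurable_EFinP.
- by move=> x _; rewrite lee_fin.
- by rewrite lee_fin.
Qed.

End key.

(** * The inequality *)

Section Lnormr_theory.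
Context (R : realType) (n : nat).
Implicit Types g : n.-tuple R -> \bar R.

(** For [r = 0] a negative [M] is exceeded everywhere, on a space of positive measure, so it does
    not enter the infimum. *)
Lemma Lnormr_ge0 (r : R) g : (forall x, 0 <= g x)%E -> (0 <= Lnormr r g)%E.
Proof.
move=> g0; rewrite /Lnormr; case: ifP => _; last exact: epow_ge0.
apply: le_ereal_inf_tmp => M /= M0; rewrite leNgt; apply/negP => Mlt0.
move: M0; rewrite (_ : [set x | _] = setT).
  by apply/eqP; rewrite gt_eqF// leb_setT_gt0.
by apply/seteqP; split => // x _ /=; exact: lt_le_trans (g0 x).
Qed.

Lemma Lnormr1 g : (forall x, 0 <= g x)%E -> Lnormr 1 g = (\int[@leb R n]_x g x)%E.
Proof.
move=> g0; rewrite /Lnormr oner_eq0 epowr1.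
  by apply: eq_integral => x _; rewrite invr1 epowr1.
by apply: integral_ge0 => x _; exact: epow_ge0.
Qed.

(** Duality with K = 0 treats all signs of [r] at once. *)
Lemma Lnormr_ae0 (r : R) g : measurable_fun setT g -> (forall x, 0 <= g x)%E ->
  r < 1 -> {ae @leb R n, forall x, g x = 0%E} -> Lnormr r g = 0%E.
Proof.
move=> mg g0 r1 gz; apply/eqP; rewrite eq_le Lnormr_ge0// andbT.
apply: Lnormr_le_dual => // u mu u0 _.
rewrite (@ge0_eq_integral_ae _ _ _ (@leb R n) _ (cst 0%E)) ?integral0//.
- apply: emeasurable_funM => //; apply/measurable_EFinP.
  exact: measurable_fun_powR.
- by move=> x; rewrite mule_ge0// lee_fin powR_ge0.
- by apply: filterS gz => x ->; rewrite mul0e.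
Qed.

End Lnormr_theory.

Lemma epow_le (R : realType) (x : \bar R) (K s : R) : (0 <= x)%E ->
  (x <= K%:E)%E -> 0 < s -> (epow x s <= (K `^ s)%:E)%E.
Proof.
case: x => [v| |]//; rewrite !lee_fin => v0 vK s0.
rewrite epow_EFin_pos// lee_fin ge0_ler_powR ?nnegrE//; first exact: ltW.
exact: le_trans vK.
Qed.

(** This settles p = 1, where every norm is the total mass. Equality holds for finite positive [x];
    at [x = 0] the factor at [i0] is 0 and annihilates the product even if others are +oo. *)
Lemma prod_epow_const (R : realType) (I : finType) (x : \bar R) (theta : I -> R)
    (i0 : I) : (0 <= x)%E -> 0 < theta i0 -> \sum_i theta i = 1 ->
  (\prod_i epow x (theta i) <= x)%E.
Proof.
move=> x0 th0 th1; case: x x0 => [v| |]//; last by move=> _; rewrite leey.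
rewrite lee_fin le_eqVlt => /predU1P[<-|v0].
  by rewrite (bigD1 i0)//= epow0_pos// mul0e.
rewrite (eq_bigr (fun i => (expR (theta i * ln v))%:E)).
  by rewrite prodEFin -expR_sum -mulr_suml th1 mul1r lnK ?posrE ?lexx.
by move=> i _; rewrite epow_EFin// /powR gt_eqF.
Qed.

Lemma pushforward_integral (R : realType) (m n : nat) (B : 'M[R]_(m, n))
    (f : n.-tuple R -> R) (g : m.-tuple R -> \bar R) : is_pushforward B f g ->
  (\int[@leb R m]_y g y = \int[@leb R n]_x (f x)%:E)%E.
Proof.
move=> [_ _ /(_ (cst 1))]; move=> /(_ (measurable_cst _) (fun=> ler01)).
under eq_integral do rewrite mule1.
by under [RHS]eq_integral do rewrite mulr1.
Qed.

Theorem theorem3p1 (R : realType) (d k : nat) (dims : 'I_k -> nat)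
  (B : forall i : 'I_k, 'M[R]_(dims i, d)) (c : 'I_k -> R)
  (p : R) (theta : 'I_k -> R) (f : d.-tuple R -> R)
  (Bf : forall i : 'I_k, (dims i).-tuple R -> \bar R) :
  (forall i y, exists x, linmap (B i) x = y) ->
  (forall i, 0 < c i) ->
  1 <= p ->
  (forall i, theta i != 0) ->
  \sum_(i < k) theta i = 1 ->
  (exists! i, 0 < theta i) ->
  measurable_fun [set: d.-tuple R] f ->
  (forall x, 0 <= f x) ->
  (forall i, is_pushforward (B i) f (Bf i)) ->
  (* 1/p_i is determined by c_i (1 - 1/p) = theta_i (1 - 1/p_i) *)
  (epow (BLconst B c) (p^-1 - 1) *
     \prod_(i < k)
       epow (Lnormr (1 - c i * (1 - p^-1) / theta i) (Bf i)) (theta i)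
   <= Lnormr p^-1 (EFin \o f))%E.
Proof.
move=> _ c0 p1 thN0 th1 [i0 [th0 uniq0]] mf f0 pf.
have thn i : i != i0 -> theta i < 0.
  move=> ii0; rewrite lt_neqAle thN0 leNgt; apply/negP => /uniq0 i0i.
  by rewrite i0i eqxx in ii0.
have mBf i : measurable_fun setT (Bf i) by have [] := pf i.
have Bf0 i y : (0 <= Bf i y)%E by have [] := pf i.
have EBf i := pushforward_integral (pf i).
move: p1; rewrite le_eqVlt => /predU1P[<-|p1].
  rewrite invr1 subrr epowr0 mul1e.
  have -> : Lnormr 1 (EFin \o f) = (\int[@leb R d]_x (f x)%:E)%E.
    by rewrite Lnormr1// => x; rewrite lee_fin.
  rewrite (eq_bigr (fun i => epow (\int[@leb R d]_x (f x)%:E)%E (theta i))).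
    by apply: (@prod_epow_const _ _ _ _ i0) => //; apply: integral_ge0 => x _; rewrite lee_fin.
  by move=> i _; rewrite ?invr1 ?subrr mulr0 mul0r subr0 Lnormr1 // EBf.
have p0 : 0 < p by exact: lt_trans p1.
have s0 : 0 < 1 - p^-1 by rewrite subr_gt0 invf_lt1.
pose r i := 1 - c i * (1 - p^-1) / theta i.
(* The sign of [theta i] decides the side of 1: duality applies at [i0], where [r i0] may be
   nonpositive, and the other exponents are positive. *)
have r0_lt1 : r i0 < 1 by rewrite ltrBlDr ltrDl divr_gt0// mulr_gt0.
have r_gt1 i : i != i0 -> 1 < r i.
  by move=> /thn ti; rewrite ltrDl oppr_gt0 nmulr_llt0 ?invr_lt0// mulr_gt0.
have rE i : 1 - r i = c i * (1 - p^-1) / theta i by rewrite subKr.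
rewrite -[X in (_ * X)%E]/(\prod_(i < k) epow (Lnormr (r i) (Bf i)) (theta i))%E.
(* As 0 * +oo = 0, one vanishing factor makes the left-hand side 0. *)
have zero i : epow (Lnormr (r i) (Bf i)) (theta i) = 0%E ->
    (epow (BLconst B c) (p^-1 - 1) *
      \prod_(i < k) epow (Lnormr (r i) (Bf i)) (theta i) = 0)%E.
  by move=> iz; rewrite (bigD1 i)//= iz mul0e mule0.
have rhs0 : (0 <= Lnormr p^-1 (EFin \o f))%E.
  by apply: Lnormr_ge0 => x; rewrite lee_fin.
have mfp : measurable_fun setT (fun x => (f x `^ p)%:E).
  by apply/measurable_EFinP; exact: measurable_fun_powR.
have fp0 x : (0 <= (f x `^ p)%:E)%E by rewrite lee_fin powR_ge0.
have rhsE : Lnormr p^-1 (EFin \o f) =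
    epow (\int[@leb R d]_x (f x `^ p)%:E)%E p^-1.
  rewrite /Lnormr gt_eqF ?invr_gt0// invrK; congr epow.
  by apply: eq_integral => x _; rewrite epow_EFin_pos.
have IA0 : (0 <= \int[@leb R d]_x (f x `^ p)%:E)%E.
  by apply: integral_ge0 => x _; exact: fp0.
have mfE : measurable_fun setT (fun x => (f x)%:E) by exact/measurable_EFinP.
case IA : (\int[@leb R d]_x (f x `^ p)%:E)%E IA0 => [A| |]// A0; last first.
  by rewrite rhsE IA epowy_pos ?invr_gt0// leey.
(* If A = 0, then [f] and hence [Bf i0] vanish almost everywhere, and the factor at [i0] is 0. *)
move: A0; rewrite lee_fin le_eqVlt => /predU1P[Az|A0].
  rewrite (zero i0)// Lnormr_ae0 ?epow0_pos//.
  apply: ge0_integral_eq0_ae; [exact: mBf|exact: Bf0|rewrite [LHS]EBf].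
  rewrite (@ge0_eq_integral_ae _ _ _ (@leb R d) _ (cst 0%E)) ?integral0//.
  have : {ae @leb R d, forall x, (f x `^ p)%:E = 0%E}.
    by apply: ge0_integral_eq0_ae => //; rewrite [LHS]IA -Az.
  by apply: filterS => x [] /powR_eq0_eq0 ->.
have f_neq0 : (\int[@leb R d]_x (f x)%:E)%E <> 0%E.
  move=> If.
  have fz : {ae @leb R d, forall x, (f x)%:E = 0%E}.
    by apply: ge0_integral_eq0_ae => // x; rewrite lee_fin.
  have : (\int[@leb R d]_x (f x `^ p)%:E = 0)%E.
    rewrite (@ge0_eq_integral_ae _ _ _ (@leb R d) _ (cst 0%E)) ?integral0//.
    by apply: filterS fz => x [] ->; rewrite powR0// gt_eqF.
  by rewrite IA => -[] Az; rewrite Az ltxx in A0.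
have sN : p^-1 - 1 < 0 by rewrite subr_lt0 invf_lt1.
have := BLconst_gt0 B c0.
case blE : (BLconst B c) => [bl| |]//; last by rewrite epowy_neg// mul0e.
rewrite lte_fin => bl0; rewrite -blE.
pose J i := (\int[@leb R (dims i)]_y epow (Bf i y) (r i)^-1)%E.
(* An infinite norm at an index other than [i0] is raised to a negative power and gives a zero
   factor. *)
have [[i [ii0 Ji]]|/forallNP Jfin] := pselect (exists i, i != i0 /\ J i = +oo%E).
  have ri0 : 0 < r i by rewrite (lt_trans _ (r_gt1 _ ii0)).
  rewrite (zero i)// /Lnormr gt_eqF// -/(J i) Ji epowy_pos// epowy_neg//.
  exact: thn.
pose M i := fine (J i).
have J0 i : (0 <= J i)%E by apply: integral_ge0 => y _; exact: epow_ge0.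
have JM i : i != i0 -> J i = (M i)%:E.
  move=> ii0; rewrite fineK// ge0_fin_numE// ltNge leye_eq; apply/negP => /eqP Ji.
  by apply: (Jfin i).
have ri0 i : i != i0 -> 0 < r i by move=> /r_gt1; exact: lt_trans.
have M0 i : i != i0 -> 0 < M i.
  move=> ii0; rewrite lt0r -lee_fin -JM// J0 andbT; apply/eqP => Mz.
  apply: f_neq0; rewrite -(EBf i).
  rewrite (@ge0_eq_integral_ae _ _ _ (@leb R _) _ (cst 0%E)) ?integral0//.
    exact: mBf.
  have : {ae @leb R _, forall y, epow (Bf i y) (r i)^-1 = 0%E}.
    apply: ge0_integral_eq0_ae.
    - exact: measurableT_comp (measurable_epow _) (mBf i).
    - by move=> y; exact: epow_ge0.
    - by rewrite [LHS](JM i ii0) Mz.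
  apply: filterS => y; have := Bf0 i y; case: (Bf i y) => [v| |]//.
    rewrite lee_fin le_eqVlt => /predU1P[<-//|v0].
    by rewrite epow_EFin// => -[] /eqP; rewrite gt_eqF// powR_gt0.
  by rewrite epowy_pos ?invr_gt0 ?ri0.
(* For [i != i0] this is the norm of [Bf i], and by [integral_mul_npow] also its pairing with the
   power 1 - r_i of its extremiser. *)
pose N i := M i `^ r i.
have LN i : i != i0 -> Lnormr (r i) (Bf i) = (N i)%:E.
  by move=> ii0; rewrite /Lnormr gt_eqF ?ri0// -/(J i) JM// epow_EFin// M0.
have N0 i : i != i0 -> 0 < N i by move=> /M0; exact: powR_gt0.
pose K := expR (holder_log p theta i0 A bl N).
have LK : (Lnormr (r i0) (Bf i0) <= K%:E)%E.
  apply: Lnormr_le_dual => //; first exact: expR_ge0.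
  move=> g mg g0 Ig; rewrite rE.
  (* An arbitrary test density at [i0], extremisers elsewhere; the bound [K] does not involve
     [g]. *)
  pose G := @eqtype.dfwith _ (fun i => (dims i).-tuple R -> R)
    (fun i => npow (Bf i) (r i) (M i)) i0 g.
  have Gi i : i != i0 -> G i = npow (Bf i) (r i) (M i).
    by move=> ii0; rewrite /G dfwith_out// eq_sym.
  have Gi0 : G i0 = g by rewrite /G dfwith_in.
  rewrite -Gi0; apply: (reverse_holder c0 p1 th0 thn th1 mf f0 pf A0 IA blE bl0 N0).
  - move=> i; have [->|ii0] := eqVneq i i0; first by rewrite Gi0.
    by rewrite Gi//; apply: measurable_npow; exact: mBf.
  - move=> i y; have [ii0|ii0] := eqVneq i i0.
      by move: y; rewrite ii0 Gi0.
    by rewrite Gi//; apply: npow_ge0; exact: M0.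
  - move=> i; have [->|ii0] := eqVneq i i0; first by rewrite Gi0.
    rewrite Gi//; apply: integral_npow; [exact: mBf|exact: M0|exact: JM].
  - move=> i ii0; rewrite Gi// -rE integral_mul_npow.
    + exact: lexx.
    + exact: mBf.
    + exact: Bf0.
    + by rewrite gt_eqF ?ri0.
    + exact: M0.
    + exact: JM.
    + by rewrite gt_eqF ?r_gt1.
  - move=> i ii0; rewrite Gi//; apply: npow_gt0_ae.
    + exact: mBf.
    + exact: Bf0.
    + exact: M0.
    + exact: JM.
    + exact: ri0.
have prodN : (\prod_(i < k | i != i0) epow (Lnormr (r i) (Bf i)) (theta i) =
    (expR (\sum_(i | i != i0) theta i * ln (N i)))%:E)%E.
  rewrite expR_sum -prodEFin; apply: eq_bigr => i ii0.
  by rewrite LN// epow_EFin ?N0// /powR gt_eqF// N0.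
rewrite rhsE IA blE !epow_EFin// (bigD1 i0)//= prodN.
apply: (@le_trans _ _ ((bl `^ (p^-1 - 1))%:E * ((K `^ theta i0)%:E *
    (expR (\sum_(i | i != i0) theta i * ln (N i)))%:E))%E).
  rewrite lee_wpmul2l ?lee_fin ?powR_ge0// lee_wpmul2r ?lee_fin ?expR_ge0//.
  by apply: epow_le => //; exact: Lnormr_ge0.
rewrite -!EFinM lee_fin /powR !gt_eqF ?expR_gt0// expRK -!expRD ler_expR.
(* The logarithms agree exactly: theta_0 ln K cancels the powers of the constant and of the other
   norms, leaving (ln A)/p. *)
rewrite le_eqVlt; apply/orP; left; apply/eqP; rewrite /holder_log.
by field; rewrite !lt0r_neq0.
Qed.
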